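(* Let $(T^*Q,\omega_B,H,F,W)$ be a CMH system with the magnetic symplectic form $\omega_B=\omega-\pi_Q^*B$ on $T^*Q$, and let $\tilde X=X^B_{(T^*Q,\omega_B,H,F,u)}$ be its dynamical vector field with a control law $u$. Let $\gamma:Q\to T^*Q$ be a one-form on $Q$, $\lambda=\gamma\circ\pi_Q:T^*Q\to T^*Q$, and for any map $\varepsilon:T^*Q\to T^*Q$ that is symplectic with respect to $\omega_B$ denote $\tilde X^\varepsilon=T\pi_Q\circ\tilde X\circ\varepsilon$. Then $\varepsilon$ is a solution of the equation $$T\varepsilon\circ X^B_{H\circ\varepsilon}=T\lambda\circ\tilde X\circ\varepsilon$$ if and only if it is a solution of the equation $$T\gamma\circ\tilde X^\varepsilon=X^B_H\circ\varepsilon ,$$ where $X^B_H$ and $X^B_{H\circ\varepsilon}$ are the magnetic Hamiltonian vector fields of the functions $H$ and $H\circ\varepsilon:T^*Q\to\mathbb R$, respectively. (The latter equation is called the Type II of Hamilton-Jacobi equation for the CMH system with control law $u$.)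
   Context: All manifolds and maps are smooth and finite dimensional. $\pi_Q:T^*Q\to Q$ is the projection, $\omega=-\mathbf d\theta$ the canonical symplectic form on $T^*Q$. $B$ is a closed two-form on $Q$; $\omega_B=\omega-\pi_Q^*B$ is a symplectic form on $T^*Q$, the magnetic symplectic form. The magnetic Hamiltonian vector field $X^B_K$ of a function $K$ on $T^*Q$ is defined by $\mathbf i_{X^B_K}\omega_B=\mathbf dK$. A one-form is regarded as a section $\gamma:Q\to T^*Q$. $\varepsilon$ is symplectic with respect to $\omega_B$ if $\varepsilon^*\omega_B=\omega_B$. A controlled magnetic Hamiltonian (CMH) system is a 5-tuple $(T^*Q,\omega_B,H,F,W)$ with $H:T^*Q\to\mathbb R$, $F:T^*Q\to T^*Q$ a fiber-preserving map (external force) and $W\subset T^*Q$ a fiber submanifold (control subset). A control law is a fiber-preserving map $u:T^*Q\to W$. The dynamical vector field is $X^B_{(T^*Q,\omega_B,H,F,u)}=X^B_H+\mathrm{vlift}(F)^B+\mathrm{vlift}(u)^B$, where $\mathrm{vlift}(F)^B=\mathrm{vlift}(F)X^B_H$ and $\mathrm{vlift}(u)^B=\mathrm{vlift}(u)X^B_H$. Here, having fixed a metric giving a splitting $T(T^*Q)=\mathcal H\oplus\mathcal V$ with $\mathcal V=\ker T\pi_Q$, $\mathrm{vlift}(F)X^B_H(\alpha_x)$ is the vertical vector at $\alpha_x\in T^*_xQ$ obtained by taking the vertical part of $TF(X^B_H(\alpha_x))\in T_{F(\alpha_x)}T^*Q$ and parallel-translating it along the straight line in $T_x^*Q$ from $F(\alpha_x)$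 to $\alpha_x$ (similarly for $u$). *)

(* Defs.v *)
(* MathComp-Analysis has no smooth manifolds: they are set up here as sets with
   an atlas, in the style where the topology is the one generated by the charts.
   Every point carries a preferred chart, and the tangent space at x is identified
   with the model space R^n through the preferred chart at x. *)
From HB Require Import structures.
From mathcomp Require Import all_boot all_order all_algebra.
From mathcomp Require Import all_classical all_reals all_analysis.
Set Implicit Arguments.
Unset Strict Implicit.
Unset Printing Implicit Defensive.
Import Order.TTheory GRing.Theory Num.Theory.
Import numFieldNormedType.Exports.
Local Open Scope classical_set_scope.
Local Open Scope ring_scope.

Section Smoothness.
Context {R : realType} {V W : normedModType R}.

(* For finite-dimensional V and open U this is the usual class C^k on U. *)
Fixpoint class_C (k : nat) (U : set V) (f : V -> W) : Prop :=
  if k is k'.+1 then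
    (forall x, U x -> differentiable f x) /\ (forall v, class_C k' U ('D_v f))
  else forall x, U x -> {for x, continuous f}.

Definition smooth_on (U : set V) (f : V -> W) := forall k, class_C k U f.

End Smoothness.

Record charted (R : realType) (n : nat) := Charted {
  pt :> Type;
  chart_index : Type;
  dom : chart_index -> set pt;
  coord : chart_index -> pt -> 'rV[R]_n;
  coord_inv : chart_index -> 'rV[R]_n -> pt;   (* inverse of coord i on coord i @` dom i *)
  chart_at : pt -> chart_index }.

Arguments dom {R n M} i : rename.
Arguments coord {R n M} i : rename.
Arguments coord_inv {R n M} i : rename.
Arguments chart_at {R n M} x : rename.

Section Manifolds.
Context {R : realType} {n : nat}.
Implicit Types M : charted R n.

Definition mopen M (U : set M) :=
  forall i : chart_index M, open (coord i @` (dom i `&` U)).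

Record smooth_manifold M : Prop := SmoothManifold {
  dom_chart_at : forall x : M, dom (chart_at x) x;
  coordK : forall (i : chart_index M) x, dom i x -> coord_inv i (coord i x) = x;
  open_overlap : forall i j : chart_index M, open (coord i @` (dom i `&` dom j));
  smooth_transition : forall i j : chart_index M,
    smooth_on (coord i @` (dom i `&` dom j)) (coord j \o coord_inv i);
  hausdorff : forall x y : M, x <> y ->
    exists U V : set M, [/\ mopen U, mopen V, U x, V y & U `&` V = set0];
  countable_basis : exists U : nat -> set M, (forall k, mopen (U k)) /\
    (forall (V : set M) x, mopen V -> V x -> exists k, U k x /\ U k `<=` V) }.

(* Smoothness of a vector-valued function on an open subset of M. *)
Definition smooth_fun_on M (W : normedModType R) (U : set M) (f : M -> W) :=
  forall i : chart_index M, smooth_on (coord i @` (dom i `&` U)) (f \o coord_inv i).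

Definition smooth_fun M (f : M -> R) := smooth_fun_on setT f.

(* Differential of a vector-valued function on M, on the tangent space at x. *)
Definition dfun M (W : normedModType R) (f : M -> W) (x : M) (v : 'rV[R]_n) : W :=
  'd (f \o coord_inv (chart_at x)) (coord (chart_at x) x) v.

(* The underlying set of TM: a pair (x, v) stands for v in T_x M. *)
Definition tangent M : Type := (M * 'rV[R]_n)%type.

Definition section M (X : M -> 'rV[R]_n) : M -> tangent M := fun x => (x, X x).

(* v in R^n, seen as the value at coord_inv i z of a tangent vector expressed in the
   chart i, rewritten in the preferred chart at coord_inv i z. *)
Definition from_chart M (i : chart_index M) (z v : 'rV[R]_n) : 'rV[R]_n :=
  'd (coord (chart_at (coord_inv i z)) \o coord_inv i) z v.

(* Conversely, a tangent vector at x expressed in the chart i. *)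
Definition to_chart M (i : chart_index M) (x : M) (v : 'rV[R]_n) : 'rV[R]_n :=
  'd (coord i \o coord_inv (chart_at x)) (coord (chart_at x) x) v.

Definition covariant1 M := M -> 'rV[R]_n -> R.
Definition covariant2 M := M -> 'rV[R]_n -> 'rV[R]_n -> R.

Definition coord1 M (t : covariant1 M) (i : chart_index M) (v z : 'rV[R]_n) : R :=
  t (coord_inv i z) (from_chart i z v).

Definition coord2 M (t : covariant2 M) (i : chart_index M) (v w z : 'rV[R]_n) : R :=
  t (coord_inv i z) (from_chart i z v) (from_chart i z w).

Definition smooth2 M (t : covariant2 M) := forall (i : chart_index M) v w,
  smooth_on (coord i @` dom i) (coord2 t i v w).

Definition is_bilinear M (t : covariant2 M) := forall x : M,
  (forall v, scalar (t x v)) /\ (forall w, scalar (t x ^~ w)).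

Definition two_form M (t : covariant2 M) :=
  [/\ smooth2 t, is_bilinear t & forall x v, t x v v = 0].

Definition riemannian_metric M (g : covariant2 M) :=
  [/\ smooth2 g, is_bilinear g, (forall x v w, g x v w = g x w v) &
      forall x v, v != 0 -> 0 < g x v v].

(* Exterior derivatives, computed at x in the preferred chart at x. *)
Definition ext_d1 M (t : covariant1 M) : covariant2 M := fun x v w =>
  'D_v (coord1 t (chart_at x) w) (coord (chart_at x) x)
  - 'D_w (coord1 t (chart_at x) v) (coord (chart_at x) x).

Definition ext_d2 M (t : covariant2 M) (x : M) (u v w : 'rV[R]_n) : R :=
  'D_u (coord2 t (chart_at x) v w) (coord (chart_at x) x)
  - 'D_v (coord2 t (chart_at x) u w) (coord (chart_at x) x)
  + 'D_w (coord2 t (chart_at x) u v) (coord (chart_at x) x).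

Definition closed_form2 M (t : covariant2 M) := forall x u v w, ext_d2 t x u v w = 0.

End Manifolds.

Section Maps.
Context {R : realType} {m n : nat} {M : charted R m} {N : charted R n}.

(* The openness clause is continuity of f. *)
Definition smooth_map (f : M -> N) := forall (i : chart_index M) (j : chart_index N),
  open (coord i @` (dom i `&` f @^-1` dom j)) /\
  smooth_on (coord i @` (dom i `&` f @^-1` dom j)) (coord j \o f \o coord_inv i).

Definition dmap (f : M -> N) (x : M) (v : 'rV[R]_m) : 'rV[R]_n :=
  'd (coord (chart_at (f x)) \o f \o coord_inv (chart_at x)) (coord (chart_at x) x) v.

Definition tangent_map (f : M -> N) : tangent M -> tangent N :=
  fun v => (f v.1, dmap f v.1 v.2).

Definition pullback2 (f : M -> N) (t : covariant2 N) : covariant2 M :=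
  fun x v w => t (f x) (dmap f x v) (dmap f x w).

End Maps.

Section Cotangent.
Context {R : realType} {n : nat} (Q : charted R n).

(* A covector at x is given by its coordinates p in the basis dual to the standard
   basis of T_x Q = R^n. *)
Definition pairing (p v : 'rV[R]_n) : R := \sum_(k < n) p 0 k * v 0 k.

(* The chart of T^*Q induced by the chart i of Q sends a covector p at x to
   (coord i x, components of p in the basis dual to the coordinate basis of i). *)
Definition cotangent : charted R (n + n) := {|
  pt := (Q * 'rV[R]_n)%type;
  chart_index := chart_index Q;
  dom := fun i a => dom i a.1;
  coord := fun i a => row_mx (coord i a.1)
    (\row_k pairing a.2 ('d (coord (chart_at a.1) \o coord_inv i) (coord i a.1)
                            (delta_mx 0 k)));
  coord_inv := fun i z => (coord_inv i (lsubmx z),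
    \row_k pairing (rsubmx z) (to_chart i (coord_inv i (lsubmx z)) (delta_mx 0 k)));
  chart_at := fun a => chart_at a.1 |}.

Definition cotangent_proj (a : cotangent) : Q := a.1.

Definition one_form (gamma : Q -> cotangent) :=
  smooth_map gamma /\ forall x, cotangent_proj (gamma x) = x.

Definition canonical_one_form : covariant1 cotangent :=
  fun a v => pairing a.2 (dmap cotangent_proj a v).

Definition canonical_two_form : covariant2 cotangent :=
  fun a v w => - ext_d1 canonical_one_form a v w.

Definition magnetic_form (B : covariant2 Q) : covariant2 cotangent :=
  fun a v w => canonical_two_form a v w - pullback2 cotangent_proj B a v w.

Definition symplectic_map (B : covariant2 Q) (eps : cotangent -> cotangent) :=
  smooth_map eps /\
  forall a v w, pullback2 eps (magnetic_form B) a v w = magnetic_form B a v w.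

(* The unique vector field X with i_X omega_B = dK. *)
Definition magnetic_field (B : covariant2 Q) (K : cotangent -> R)
    (a : cotangent) : 'rV[R]_(n + n) :=
  xget 0 [set X | forall w, magnetic_form B a X w = dfun K a w].

Definition fiber_preserving (F : cotangent -> cotangent) :=
  forall a, cotangent_proj (F a) = cotangent_proj a.

(* W is an embedded submanifold of T^*Q, locally the zero set of a submersion f
   (so that T_b W = ker T_b f), on which the projection to Q is a surjective
   submersion. *)
Definition fiber_submanifold (W : set cotangent) :=
  (forall x : Q, exists2 a, W a & cotangent_proj a = x) /\
  forall a, W a -> exists (k : nat) (U : set cotangent) (f : cotangent -> 'rV[R]_k),
    [/\ mopen U, U a & smooth_fun_on U f] /\
    [/\ forall b, U b -> forall y, exists v, dfun f b v = y,
        forall b, U b -> W b <-> f b = 0 &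
        forall b, U b -> W b -> forall y, exists v,
          dfun f b v = 0 /\ dmap cotangent_proj b v = y].

Section VerticalLift.

(* A Riemannian metric on T^*Q; it splits T(T^*Q) as the sum of the vertical
   bundle ker T pi_Q and of its orthogonal complement. *)
Variable g : covariant2 cotangent.

Definition vertical (a : cotangent) : set 'rV[R]_(n + n) :=
  [set v | dmap cotangent_proj a v = 0].

Definition horizontal (a : cotangent) : set 'rV[R]_(n + n) :=
  [set v | forall w, vertical a w -> g a v w = 0].

Definition vertical_part (a : cotangent) (v : 'rV[R]_(n + n)) : 'rV[R]_(n + n) :=
  xget 0 [set w | vertical a w /\ horizontal a (v - w)].

(* Velocity at t = 0 of the curve t |-> a + t eta in the fiber through a. *)
Definition fiber_velocity (a : cotangent) (eta : 'rV[R]_n) : 'rV[R]_(n + n) :=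
  'D_1 (fun t : R => coord (chart_at a) ((a.1, a.2 + t *: eta) : cotangent)) 0.

(* Parallel translation from b to a, two points of the same fiber, of a vertical
   vector along the straight line from b to a: the velocity of b + t eta is sent to
   the velocity of a + t eta. *)
Definition parallel_translation (b a : cotangent) (v : 'rV[R]_(n + n)) :
    'rV[R]_(n + n) :=
  fiber_velocity a (xget 0 [set eta | fiber_velocity b eta = v]).

Definition vlift (F : cotangent -> cotangent) (X : cotangent -> 'rV[R]_(n + n))
    (a : cotangent) : 'rV[R]_(n + n) :=
  parallel_translation (F a) a (vertical_part (F a) (dmap F a (X a))).

End VerticalLift.

Record CMH_system := CMHSystem {
  magnetic_B : covariant2 Q;
  magnetic_B_form : two_form magnetic_B;
  magnetic_B_closed : closed_form2 magnetic_B;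
  hamiltonian : cotangent -> R;
  hamiltonian_smooth : smooth_fun hamiltonian;
  force : cotangent -> cotangent;
  force_smooth : smooth_map force;
  force_fiber : fiber_preserving force;
  control_set : set cotangent;
  control_set_fiber : fiber_submanifold control_set }.

Definition control_law (S : CMH_system) (u : cotangent -> cotangent) :=
  [/\ smooth_map u, fiber_preserving u & forall a, control_set S (u a)].

Definition dynamical_field (g : covariant2 cotangent) (S : CMH_system)
    (u : cotangent -> cotangent) (a : cotangent) : 'rV[R]_(n + n) :=
  let X := magnetic_field (magnetic_B S) (hamiltonian S) in
  X a + vlift g (force S) X a + vlift g u X a.

End Cotangent.

(* Main.v *)
(* Since eps preserves the nondegenerate form omega_B, T eps is bijective and
   T eps o X_{H o eps} = X_H o eps.  By the chain rule, T lambda = T gamma o T pi_Q.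
   So both equations say that X_H o eps = T gamma o T pi_Q o X o eps.
   Nondegeneracy is read off in canonical coordinates, where the canonical one-form
   is p dq because the pairing of covectors and vectors does not depend on the chart. *)
From HB Require Import structures.
From mathcomp Require Import all_boot all_order all_algebra.
From mathcomp Require Import all_classical all_reals all_analysis.
Require Import Defs.
Set Implicit Arguments.
Unset Strict Implicit.
Unset Printing Implicit Defensive.
Import Order.TTheory GRing.Theory Num.Theory.
Import numFieldNormedType.Exports.
Local Open Scope classical_set_scope.
Local Open Scope ring_scope.

(** * Differentials as local objects, and linear algebra of row vectors *)

Section Differentials.
Context {R : realType}.

(** The first-order expansion of [g] at [a] is a statement about germs, so [f] inherits it, and
    uniqueness of the differential does the rest. Locality matters because chart round trips cancel
    only on chart domains. *)
Lemma near_eq_diff (V W : normedModType R) (f g : V -> W) (a : V) :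
  {near a, f =1 g} -> differentiable g a ->
  differentiable f a /\ 'd f a = 'd g a :> (V -> W).
Proof.
move=> fg dg; have fga : f a = g a := nbhs_singleton fg.
have f_approx : f \o shift a = cst (f a) + 'd g a +o_ 0 id.
  have /eqaddoP g_approx := diff_locally dg.
  apply/eqaddoP => e e0; have near_fg : \forall x \near 0, f (shift a x) = g (shift a x).
    by rewrite (near_shift a); apply: filterS fg => x; rewrite /= sub0r addrNK.
  by apply: filterS2 (g_approx e e0) near_fg => x; rewrite !fctE fga => + ->.
have df : 'd f a = 'd g a :> (V -> W).
  by apply: diff_unique f_approx; exact: diff_continuous.
split => //; apply/diff_locallyP; rewrite df; split => //.
exact: diff_continuous.
Qed.

Lemma near_eq_diff_comp (U V W : normedModType R) (h : U -> W) (f : U -> V) (g : V -> W) a :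
  {near a, h =1 g \o f} -> differentiable f a -> differentiable g (f a) ->
  differentiable h a /\ forall v, 'd h a v = 'd g (f a) ('d f a v).
Proof.
move=> hgf df dg; have dgf := differentiable_comp df dg.
by have [dh ->] := near_eq_diff hgf dgf; split => // v; rewrite diff_comp.
Qed.

Lemma differentiable_rV (V : normedModType R) m (f : V -> 'rV[R]_m) (a : V) :
  (forall k, differentiable (fun z => f z 0 k) a) -> differentiable f a.
Proof.
move=> df; have -> : f = \sum_(k < m) (fun z => f z 0 k *: delta_mx 0 k).
  by apply/funext => z; rewrite fct_sumE [LHS]row_sum_delta.
by apply: differentiable_sum => k; exact: differentiableZl.
Qed.

Lemma smooth_on_differentiable (V W : normedModType R) (U : set V) (f : V -> W) x :
  smooth_on U f -> U x -> differentiable f x.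
Proof. by move=> /(_ 1%N)[df _]; exact: df. Qed.

Lemma smooth_on_derive (V W : normedModType R) (U : set V) (f : V -> W) v :
  smooth_on U f -> smooth_on U ('D_v f).
Proof. by move=> sf k; have [_] := sf k.+1; exact. Qed.

Lemma near_open_image T (V : topologicalType) (U : set T) (f : T -> V) x :
  open (f @` U) -> U x -> \forall z \near f x, exists2 y, U y & z = f y.
Proof.
move=> oU Ux; apply: (@filterS _ (nbhs (f x)) _ (f @` U)).
  by move=> z [y Uy <-]; exists y.
by apply: open_nbhs_nbhs; split => //; exists x.
Qed.

(** A square matrix with trivial left kernel is invertible. *)
Lemma linear_inj_surj m (f : {linear 'rV[R]_m -> 'rV[R]_m}) :
  (forall v, f v = 0 -> v = 0) -> forall w, exists v, f v = w.
Proof.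
move=> f_inj w; have f_unit : lin1_mx f \in unitmx.
  rewrite -row_free_unit; apply: inj_row_free => v.
  by rewrite mul_rV_lin1; exact: f_inj.
by exists (w *m invmx (lin1_mx f)); rewrite -mul_rV_lin1 mulmxKV.
Qed.

End Differentials.

(** * Pairing of covectors with vectors, and transposes *)

Section Pairing.
Context {R : realType}.

Lemma pairingC n (p v : 'rV[R]_n) : pairing p v = pairing v p.
Proof. by apply: eq_bigr => k _; rewrite mulrC. Qed.

Lemma pairing_scalar n (p : 'rV[R]_n) : scalar (pairing p).
Proof.
move=> c v w; rewrite /pairing mulr_sumr -big_split; apply: eq_bigr => k _ /=.
by rewrite !mxE mulrDr mulrCA.
Qed.

Lemma pairing0 n (p : 'rV[R]_n) : pairing p 0 = 0.
Proof. by apply: big1 => k _; rewrite mxE mulr0. Qed.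

Lemma pairingNl n (p v : 'rV[R]_n) : pairing (- p) v = - pairing p v.
Proof. by rewrite /pairing -sumrN; apply: eq_bigr => k _; rewrite mxE mulNr. Qed.

Lemma pairing_delta n (p : 'rV[R]_n) k : pairing p (delta_mx 0 k) = p 0 k.
Proof.
rewrite /pairing (bigD1 k) //= mxE !eqxx mulr1 big1 ?addr0 // => l lk.
by rewrite mxE (negbTE lk) andbF mulr0.
Qed.

Lemma pairing_row n (f : 'rV[R]_n -> R) v :
  scalar f -> pairing (\row_k f (delta_mx 0 k)) v = f v.
Proof.
move=> f_lin; pose fM := GRing.isLinear.Build _ _ _ _ _ f_lin.
pose fL : {scalar 'rV[R]_n} := HB.pack f fM.
rewrite -[f v]/(fL v) [in RHS](row_sum_delta v) linear_sum.
by apply: eq_bigr => k _; rewrite mxE linearZ /= mulrC.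
Qed.

(** The row is the transpose of [f] applied to [p]; both [coord] and [coord_inv] of the cotangent
    bundle build their momentum components in this way. *)
Lemma pairing_transpose m n (p : 'rV[R]_n) (f : {linear 'rV[R]_m -> 'rV[R]_n}) (w : 'rV[R]_m) :
  pairing (\row_k pairing p (f (delta_mx 0 k))) w = pairing p (f w).
Proof.
apply: (@pairing_row m (fun u => pairing p (f u))) => c u v.
by rewrite linearP pairing_scalar.
Qed.

End Pairing.

(** * Chart changes on a manifold and their cocycle rule *)

Section Transitions.
Context {R : realType} {n : nat} (M : charted R n) (hM : smooth_manifold M).
Implicit Types (i j k : chart_index M) (x : M).

Lemma overlap_near i j x : dom i x -> dom j x ->
  \forall z \near coord i x, exists2 y, (dom i y /\ dom j y) & z = coord i y.
Proof. by move=> ix jx; apply: near_open_image => //; exact: open_overlap. Qed.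

Lemma transition_differentiable i j x : dom i x -> dom j x ->
  differentiable (coord j \o coord_inv i) (coord i x).
Proof.
move=> ix jx; apply: smooth_on_differentiable (smooth_transition hM i j) _.
by exists x.
Qed.

Lemma transition_id i x v : dom i x ->
  'd (coord i \o coord_inv i) (coord i x) v = v.
Proof.
move=> ix; have [||_ ->] := @near_eq_diff _ _ _ (coord i \o coord_inv i) idfun (coord i x).
- apply: filterS (overlap_near ix ix) => _ [y [iy _] ->] /=.
  by rewrite coordK.
- by apply: linear_differentiable => ?; exact: cvg_id.
by rewrite diff_lin // => ?; exact: cvg_id.
Qed.

(** The cocycle rule: the round trip through chart [j] cancels on the overlap of [i] and [j], a
    neighbourhood of [x], so the chain rule applies. *)
Lemma transition_comp i j k x v : dom i x -> dom j x -> dom k x ->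
  'd (coord k \o coord_inv j) (coord j x) ('d (coord j \o coord_inv i) (coord i x) v) =
  'd (coord k \o coord_inv i) (coord i x) v.
Proof.
move=> ix jx kx; set f := coord k \o coord_inv j; set g := coord j \o coord_inv i.
have gx : g (coord i x) = coord j x by rewrite /g /= coordK.
have [|||_ /(_ v) fg_diff] :=
    @near_eq_diff_comp _ _ _ _ (coord k \o coord_inv i) g f (coord i x).
- apply: filterS (overlap_near ix jx) => _ [y [iy jy] ->].
  by rewrite /f /g /= !coordK.
- exact: transition_differentiable.
- by rewrite gx; exact: transition_differentiable.
by rewrite -gx; exact: esym fg_diff.
Qed.

End Transitions.

(** * Induced charts of the cotangent bundle *)

Section CotangentCharts.
Context {R : realType} {n : nat} (Q : charted R n) (hQ : smooth_manifold Q).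
Implicit Types (i j : chart_index Q) (a b : cotangent Q) (z : 'rV[R]_(n + n)).

Lemma pairing_coord_inv i z x w : dom i x -> lsubmx z = coord i x ->
  pairing (coord_inv (M := cotangent Q) i z).2 w =
  pairing (rsubmx z) (to_chart i x w).
Proof. by move=> ix zx; rewrite /= pairing_transpose zx coordK. Qed.

(** The two transposed chart changes compose, by the cocycle rule, to the differential of an
    identity transition. *)
Lemma cotangent_coordK i a : dom i a.1 ->
  coord_inv (M := cotangent Q) i (coord (M := cotangent Q) i a) = a.
Proof.
case: a => x p /= ix; rewrite row_mxKl row_mxKr coordK //; congr pair.
apply/rowP => k; rewrite mxE pairing_transpose.
by rewrite transition_comp // ?transition_id ?pairing_delta //; exact: dom_chart_at.
Qed.

(** Chart domains of $T^*Q$ are full preimages of those of $Q$, so it is enough to pull the base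
    overlap back along the continuous [lsubmx]. *)
Lemma lsubmx_near z i j x : dom i x -> dom j x -> lsubmx z = coord i x ->
  \forall z' \near z, exists2 y, (dom i y /\ dom j y) & lsubmx z' = coord i y.
Proof.
move=> ix jx zx.
have : \forall y' \near lsubmx z, exists2 y, (dom i y /\ dom j y) & y' = coord i y.
  by rewrite zx; exact: overlap_near.
by move/(@continuous_lsubmx _ _ _ _ z).
Qed.

(* The momentum components of the transition involve first derivatives of the
   transitions of Q, so this is where smoothness of order two is used. *)
Lemma cotangent_transition_differentiable z i j x :
  dom i x -> dom j x -> lsubmx z = coord i x ->
  differentiable (coord (M := cotangent Q) j \o coord_inv (M := cotangent Q) i) z.
Proof.
move=> ix jx zx; pose phi := coord j \o coord_inv i; pose psi := coord i \o coord_inv j.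
(* [D z' k l] is an old momentum component times an entry of the Jacobian of the inverse transition
   [psi]; summing over [l] gives the [k]-th new momentum. [F] is thus the transition in closed form,
   valid near [z]. *)
pose D z' k l := rsubmx z' 0 l * 'D_(delta_mx 0 k) psi (phi (lsubmx z')) 0 l.
pose F z' : 'rV[R]_(n + n) :=
  row_mx (phi (lsubmx z')) (\row_k \sum_l D z' k l).
have phix : phi (lsubmx z) = coord j x by rewrite zx /phi /= coordK.
have dphi : differentiable (phi \o lsubmx) z.
  apply: differentiable_comp; first exact: differentiable_lsubmx.
  by rewrite zx; exact: transition_differentiable.
suff dF : differentiable F z.
  apply: (proj1 (near_eq_diff _ dF)).
  apply: filterS (lsubmx_near ix jx zx) => z' [y [iy jy] z'y].
  rewrite /F /phi /= z'y coordK //; congr row_mx; apply/rowP => k.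
  rewrite !mxE.
  have := pairing_coord_inv
    ('d (coord (chart_at y) \o coord_inv j) (coord j y) (delta_mx 0 k)) iy z'y.
  rewrite /= z'y coordK // => ->.
  (* The preferred chart at [y] varies with [y] without any regularity; the cocycle rule eliminates
     it in favour of [psi]. *)
  rewrite /to_chart transition_comp //; last exact: dom_chart_at.
  rewrite -deriveE; last exact: transition_differentiable.
  by apply: eq_bigr => l _; rewrite /D /phi /= z'y coordK.
apply: differentiable_rV => k; case: (splitP k) => l kl.
  have -> : (fun z' => F z' 0 k) = (fun y : 'rV[R]_n => y 0 l) \o (phi \o lsubmx).
    apply/funext => z'; rewrite /F (_ : k = lshift n l) ?row_mxEl //.
    exact: val_inj.
  by apply: differentiable_comp => //; exact: differentiable_coord.
have -> : (fun z' => F z' 0 k) = \sum_m (fun z' => D z' l m).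
  apply/funext => z'; rewrite /F (_ : k = rshift n l) ?row_mxEr ?mxE ?fct_sumE //.
  exact: val_inj.
apply: differentiable_sum => m.
apply: (@differentiableM _ _ (fun z' => rsubmx z' 0 m)
  (fun z' => 'D_(delta_mx 0 l) psi (phi (lsubmx z')) 0 m)).
  apply: (@differentiable_comp _ _ _ _ rsubmx (fun y => y 0 m)).
    exact: differentiable_rsubmx.
  exact: differentiable_coord.
apply: (@differentiable_comp _ _ _ _ ('D_(delta_mx 0 l) psi \o (phi \o lsubmx))
  (fun y => y 0 m)).
  apply: differentiable_comp => //=; rewrite phix.
  apply: smooth_on_differentiable (smooth_on_derive _ (smooth_transition hQ j i)) _.
  by exists x.
exact: differentiable_coord.
Qed.

End CotangentCharts.

(** * Differentials of linear projections and linear forms *)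

Lemma diff_lsubmx {R : realType} m1 m2 (z v : 'rV[R]_(m1 + m2)) : 'd lsubmx z v = lsubmx v.
Proof. by rewrite diff_lin //; exact: continuous_lsubmx. Qed.

Lemma diff_comp_lsubmx {R : realType} (W : normedModType R) m1 m2
    (g : 'rV[R]_m1 -> W) (z v : 'rV[R]_(m1 + m2)) :
  differentiable g (lsubmx z) -> 'd (g \o lsubmx) z v = 'd g (lsubmx z) (lsubmx v).
Proof.
move=> dg; rewrite (diff_comp (differentiable_lsubmx _) dg) [LHS]/=.
by congr (_ _); exact: diff_lsubmx.
Qed.

Lemma diff_lsubmx_comp {R : realType} (V : normedModType R) m1 m2
    (f : V -> 'rV[R]_(m1 + m2)) a v :
  differentiable f a -> 'd (lsubmx \o f) a v = lsubmx ('d f a v).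
Proof.
move=> df; rewrite (diff_comp df (differentiable_lsubmx _)) [LHS]/=.
exact: diff_lsubmx.
Qed.

Lemma derive_scalar {R : realType} (V : normedModType R) (f : V -> R) a v :
  scalar f -> 'D_v f a = f v.
Proof.
move=> f_lin; apply: cvg_lim => //; apply: cvg_near_cst; near=> h.
have h0 : h != 0 by near: h; exact: nbhs_dnbhs_neq.
by rewrite /= f_lin addrK -[LHS]/(h^-1 * (h * f v)) mulKf.
Unshelve. all: by end_near. Qed.

(** * Tangent map of the projection, and the canonical forms in coordinates *)

Section TangentMaps.
Context {R : realType} {n : nat} (Q : charted R n) (hQ : smooth_manifold Q).
Implicit Types (i j : chart_index Q) (a b : cotangent Q) (z v w : 'rV[R]_(n + n)).

(** The preferred charts at [a] and at [a.1] have the same index, so the projection reads as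
    [lsubmx] near the point. *)
Lemma dmap_cotangent_proj a v : dmap (@cotangent_proj R n Q) a v = lsubmx v.
Proof.
rewrite /dmap; pose i := chart_at a.1; set h := (X in 'd X _).
have ia : dom i a.1 by exact: dom_chart_at.
have [|||_ ->] := @near_eq_diff_comp _ _ _ _ h lsubmx id (coord (chart_at a) a).
- have aE : lsubmx (coord (chart_at a) a) = coord i a.1 by rewrite row_mxKl.
  apply: filterS (lsubmx_near hQ ia ia aE) => z [y [iy _] zy].
  by rewrite /h /= zy coordK.
- exact: differentiable_lsubmx.
- by apply: (@linear_differentiable _ _ _ idfun) => y; exact: cvg_id.
rewrite diff_lsubmx (@diff_lin _ _ _ idfun) // => y; exact: cvg_id.
Qed.

(** In the preferred charts the composite is the local expression of [f] after [lsubmx]. With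
    [gamma] for [f] this gives $T\lambda=T\gamma\circ T\pi_Q$. *)
Lemma dmap_comp_proj m (N : charted R m) (f : Q -> N) a v :
  (forall y : N, dom (chart_at y) y) -> smooth_map f ->
  dmap (f \o @cotangent_proj R n Q) a v = dmap f a.1 (dmap (@cotangent_proj R n Q) a v).
Proof.
move=> hN sf; rewrite dmap_cotangent_proj /dmap.
set i := chart_at a; set j := chart_at _.
have aE : lsubmx (coord i a) = coord (chart_at a.1) a.1 by rewrite row_mxKl.
set h := coord j \o f \o coord_inv (chart_at a.1).
have dh : differentiable h (lsubmx (coord i a)).
  rewrite aE; have [_ /smooth_on_differentiable] := sf (chart_at a.1) j; apply.
  by exists a.1 => //; split; [exact: dom_chart_at | exact: hN].
have d_eq : 'd (h \o lsubmx) (coord i a) v = 'd h (lsubmx (coord i a)) (lsubmx v).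
  exact: diff_comp_lsubmx.
by rewrite aE in d_eq; exact: d_eq.
Qed.

Lemma lsubmx_from_chart i x z v : dom i x -> lsubmx z = coord i x ->
  lsubmx (from_chart (M := cotangent Q) i z v) =
  'd (coord (chart_at x) \o coord_inv i) (coord i x) (lsubmx v).
Proof.
move=> ix zx; have jx := dom_chart_at hQ x.
have bE : chart_at (coord_inv (M := cotangent Q) i z) = chart_at x.
  by rewrite /= zx coordK.
rewrite /from_chart bE; set j := chart_at x in jx *.
pose T := coord (M := cotangent Q) j \o coord_inv (M := cotangent Q) i.
have dT : differentiable T z by apply: cotangent_transition_differentiable ix jx zx.
rewrite -[LHS]/(lsubmx ('d T z v)) -diff_lsubmx_comp //.
have -> : lsubmx \o T = (coord j \o coord_inv i) \o lsubmx.
  by apply/funext => z'; rewrite /= row_mxKl.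
by rewrite diff_comp_lsubmx zx //; exact: transition_differentiable.
Qed.

(** The covector brings in [to_chart] and the vector [from_chart]; these chart changes are inverse
    to each other on the base components. *)
Lemma coord1_canonical_one_form i x z v : dom i x -> lsubmx z = coord i x ->
  coord1 (@canonical_one_form R n Q) i v z = pairing (rsubmx z) (lsubmx v).
Proof.
move=> ix zx; rewrite /coord1 /canonical_one_form dmap_cotangent_proj.
rewrite (pairing_coord_inv hQ _ ix zx) (lsubmx_from_chart _ ix zx).
rewrite /to_chart transition_comp ?transition_id //; exact: dom_chart_at.
Qed.

Lemma ext_d1_canonical_one_form a v w :
  ext_d1 (@canonical_one_form R n Q) a v w =
  pairing (rsubmx v) (lsubmx w) - pairing (rsubmx w) (lsubmx v).
Proof.
suff D u u' : 'D_u (coord1 (@canonical_one_form R n Q) (chart_at a) u') (coord (chart_at a) a) =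
    pairing (rsubmx u) (lsubmx u') by rewrite /ext_d1 !D.
have ia := dom_chart_at hQ a.1.
have aE : lsubmx (coord (chart_at a) a) = coord (chart_at a.1) a.1 by rewrite row_mxKl.
(* Near [a] the coefficient is linear in the momentum, so its derivative along [u] is its value at
   [u]. *)
rewrite (near_eq_derive (g := pairing (lsubmx u') \o rsubmx)); last first.
  apply: filterS (lsubmx_near hQ ia ia aE) => z [y [iy _] zy].
  by rewrite (coord1_canonical_one_form _ iy zy) pairingC.
rewrite derive_scalar /= 1?pairingC // => c z z'.
by rewrite /= linearP pairing_scalar.
Qed.

End TangentMaps.

(** * Nondegeneracy of $\omega_B$ and magnetic Hamiltonian fields *)

Section MagneticForm.
Context {R : realType} {n : nat} (Q : charted R n) (hQ : smooth_manifold Q).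
Variables (B : covariant2 Q) (hB : is_bilinear B).
Implicit Types (a : cotangent Q) (v w : 'rV[R]_(n + n)).

(* In canonical coordinates omega_B is dq /\ dp - B. *)
Lemma magnetic_formE a v w : magnetic_form B a v w =
  pairing (rsubmx w) (lsubmx v) - pairing (rsubmx v) (lsubmx w)
  - B a.1 (lsubmx v) (lsubmx w).
Proof.
rewrite /magnetic_form /canonical_two_form ext_d1_canonical_one_form // opprB.
by rewrite /pullback2 !dmap_cotangent_proj.
Qed.

Lemma bilinear_form0r x q : B x q 0 = 0.
Proof.
have [B_lin _] := hB x; have := B_lin q (-1) 0 0.
by rewrite scaler0 addr0 mulN1r addNr.
Qed.

(** Vertical test vectors kill the [B] term and recover the base part; test vectors with zero
    momentum part then recover the momentum part, the [B] terms being equal by then. *)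
Lemma magnetic_form_inj a v v' :
  (forall w, magnetic_form B a v w = magnetic_form B a v' w) -> v = v'.
Proof.
move=> vv'; have lvv' : lsubmx v = lsubmx v'.
  apply/rowP => k; have := vv' (row_mx 0 (delta_mx 0 k)).
  rewrite !magnetic_formE row_mxKl row_mxKr !pairing0 !bilinear_form0r !subr0.
  by rewrite ![pairing (delta_mx 0 k) _]pairingC !pairing_delta.
rewrite -[v]hsubmxK -[v']hsubmxK lvv'; congr row_mx.
apply/rowP => k; have := vv' (row_mx (delta_mx 0 k) 0).
rewrite !magnetic_formE row_mxKl row_mxKr lvv' !pairing_delta.
by move/addIr/addrI/oppr_inj.
Qed.

Lemma magnetic_form_surj a (l : 'rV[R]_(n + n) -> R) : scalar l ->
  exists v, forall w, magnetic_form B a v w = l w.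
Proof.
move=> l_lin.
have ll_lin : scalar (fun q : 'rV[R]_n => l (row_mx q 0)).
  by move=> c q q'; rewrite -l_lin scale_row_mx add_row_mx scaler0 addr0.
have lr_lin : scalar (fun p : 'rV[R]_n => l (row_mx 0 p)).
  by move=> c p p'; rewrite -l_lin scale_row_mx add_row_mx scaler0 addr0.
(* Vertical [w] force the base part [q]; vectors with zero momentum part then force [- p], where [p]
   absorbs the [B] term of the already known [q]. *)
pose q := \row_k l (row_mx 0 (delta_mx 0 k)).
pose p := \row_k (l (row_mx (delta_mx 0 k) 0) + B a.1 q (delta_mx 0 k)).
exists (row_mx q (- p)) => w; rewrite magnetic_formE row_mxKl row_mxKr.
rewrite pairingC (pairing_row _ lr_lin) pairingNl opprK.
rewrite (@pairing_row _ _ (fun u => l (row_mx u 0) + B a.1 q u)); last first.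
  move=> c u u'; have [B_lin _] := hB a.1.
  by rewrite ll_lin B_lin mulrDr addrACA.
rewrite addrA addrK -[RHS](congr1 l (hsubmxK w)).
rewrite -[row_mx (lsubmx w) (rsubmx w)]scale1r.
have -> : 1 *: row_mx (lsubmx w) (rsubmx w) =
    1 *: row_mx (lsubmx w) 0 + row_mx 0 (rsubmx w).
  by rewrite !scale1r add_row_mx addr0 add0r.
by rewrite l_lin mul1r addrC.
Qed.

Lemma magnetic_fieldP (K : cotangent Q -> R) a w :
  magnetic_form B a (magnetic_field B K a) w = dfun K a w.
Proof.
(* Existence of a solution ensures that [xget] returns one and not its default value 0. *)
have [|v vP] := @magnetic_form_surj a (dfun K a).
  by move=> c u u'; rewrite /dfun linearP.
rewrite /magnetic_field.
exact: (@xgetPex _ 0 [set X | forall w, magnetic_form B a X w = dfun K a w]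
  (ex_intro _ v vP)).
Qed.

(** The openness clause of [smooth_map] supplies a neighbourhood on which the round trip through the
    chart at [f a] cancels; the chain rule then applies. *)
Lemma dfun_comp (K : cotangent Q -> R) (f : cotangent Q -> cotangent Q) a v :
  smooth_map f -> smooth_fun K -> dfun (K \o f) a v = dfun K (f a) (dmap f a v).
Proof.
move=> sf sK; rewrite /dfun /dmap; set i := chart_at a; set j := chart_at (f a).
have ia : dom i a by exact: dom_chart_at hQ _.
have jfa : dom j (f a) by exact: dom_chart_at hQ _.
have iK b : dom i b -> coord_inv i (coord i b) = b by exact: cotangent_coordK.
have jK b : dom j b -> coord_inv j (coord j b) = b by exact: cotangent_coordK.
have [f_open f_smooth] := sf i j.
pose F := coord j \o f \o coord_inv i.
have Fa : F (coord i a) = coord j (f a) by rewrite /F /comp iK.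
have a_near : (dom i `&` f @^-1` dom j) a by split.
have [|||_ /(_ v) Kf_diff] := @near_eq_diff_comp _ _ _ _ ((K \o f) \o coord_inv i)
  F (K \o coord_inv j) (coord i a).
- apply: filterS (near_open_image f_open a_near) => _ [b [ib jfb] ->].
  by rewrite /F /comp (iK b ib) (jK (f b) jfb).
- exact: smooth_on_differentiable f_smooth (ex_intro2 _ _ a a_near erefl).
- rewrite Fa.
  exact: smooth_on_differentiable (sK j) (ex_intro2 _ _ (f a) (conj jfa I) erefl).
by rewrite -Fa; exact: Kf_diff.
Qed.

(* T eps is injective because omega_B is nondegenerate, hence bijective, so
   i_X omega_B = d(H \o eps) can be tested on vectors of the form T eps w. *)
Lemma magnetic_field_symplectic (H : cotangent Q -> R) (eps : cotangent Q -> cotangent Q) a :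
  symplectic_map B eps -> smooth_fun H ->
  dmap eps a (magnetic_field B (H \o eps) a) = magnetic_field B H (eps a).
Proof.
move=> [eps_smooth eps_symp] sH.
have dmap_inj v : dmap eps a v = 0 -> v = 0.
  move=> v0; apply: (@magnetic_form_inj a) => w.
  by rewrite -!eps_symp /pullback2 v0 /dmap linear0.
have [X epsX] := linear_inj_surj dmap_inj (magnetic_field B H (eps a)).
rewrite -[RHS]epsX; congr (dmap _ _ _); apply/esym/(@magnetic_form_inj a) => w.
rewrite magnetic_fieldP dfun_comp // -eps_symp /pullback2.
by rewrite -magnetic_fieldP -epsX.
Qed.

End MagneticForm.

Theorem theorem3p4 (R : realType) (n : nat) (Q : charted R n)
  (hQ : smooth_manifold Q)
  (g : covariant2 (cotangent Q)) (hg : riemannian_metric g)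
  (S : CMH_system Q)
  (u : cotangent Q -> cotangent Q) (hu : control_law S u)
  (gamma : Q -> cotangent Q) (hgamma : one_form gamma)
  (eps : cotangent Q -> cotangent Q)
  (heps : symplectic_map (magnetic_B S) eps) :
  let B := magnetic_B S in
  let H := hamiltonian S in
  let piQ := @cotangent_proj R n Q in
  let lambda := gamma \o piQ in
  let X := section (dynamical_field g S u) in
  let X_eps := tangent_map piQ \o X \o eps in
  tangent_map eps \o section (magnetic_field B (H \o eps))
    = tangent_map lambda \o X \o eps
  <->
  tangent_map gamma \o X_eps = section (magnetic_field B H) \o eps.
Proof.
move=> B H piQ lambda X X_eps.
have [_ B_bilinear _] : two_form B := magnetic_B_form S.
have eps_field : tangent_map eps \o section (magnetic_field B (H \o eps)) =
    section (magnetic_field B H) \o eps.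
  apply/funext => a; rewrite /tangent_map /section /comp; congr pair.
  exact: (magnetic_field_symplectic hQ B_bilinear a heps (@hamiltonian_smooth _ _ _ S)).
have lambda_field : tangent_map lambda \o X \o eps = tangent_map gamma \o X_eps.
  apply/funext => a; rewrite /X_eps /tangent_map /comp; congr pair.
  have dom_at (b : cotangent Q) : dom (chart_at b) b := dom_chart_at hQ b.1.
  have [gamma_smooth _] := hgamma.
  exact: (dmap_comp_proj hQ _ _ dom_at gamma_smooth).
(* The left side of each equation has been identified with the right side of the other, so both
   directions are chains of equalities. *)
split=> eps_sol.
  exact: etrans (esym lambda_field) (etrans (esym eps_sol) eps_field).
exact: etrans eps_field (etrans (esym eps_sol) (esym lambda_field)).
Qed.
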